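(* Let $1\le p\le n-1$. If $S\in\{RQ_p(n),\,I(n,p)\}$, then $S$ is abundant.
   Context: Let $[n]=\{1,\dots,n\}$ with its usual order. A partial transformation of $[n]$ is a function $\rho$ whose domain $\mathrm{Dom}\,\rho$ and image $\mathrm{Im}\,\rho$ are subsets of $[n]$ (the empty map is allowed). Maps are written on the right and composed left to right: $x(\rho\sigma)=(x\rho)\sigma$. $\rho$ is isotone if $x\le y$ implies $x\rho\le y\rho$ for all $x,y\in\mathrm{Dom}\,\rho$; antitone if $x\le y$ implies $x\rho\ge y\rho$; monotone if isotone or antitone; decreasing if $x\rho\le x$ for all $x\in\mathrm{Dom}\,\rho$. $\mathcal{DORP}_n$ is the monoid, under composition, of all monotone and decreasing partial transformations of $[n]$. The height of $\rho$ is $|\mathrm{Im}\,\rho|$. For $0\le p\le n-1$, $I(n,p)=\{\rho\in\mathcal{DORP}_n:|\mathrm{Im}\,\rho|\le p\}$, a two-sided ideal. For $p\ge1$, $RQ_p(n)=I(n,p)/I(n,p-1)$ is the Rees quotient: its nonzero elements are the elements of $\mathcal{DORP}_n$ of height exactly $p$, and a product of two of them is their composite if that has height $p$ and is the zero $\mathbf{0}$ otherwise. On a semigroup $S$, $\mathcal{L}^*=\{(a,b)\in S\times S:\ \forall x,y\in S^1,\ ax=ay\iff bx=by\}$ and $\mathcal{R}^*=\{(a,b)\in S\times S:\ \forall x,y\in S^1,\ xa=ya\iff xb=yb\}$. A semigroup is regular if for every $x\in S$ there is $y\in S$ with $x=xyx$. A non-regular semigroup is called abundant if each of its $\mathcal{L}^*$-classes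 and each of its $\mathcal{R}^*$-classes contains an idempotent. *)

(* Defs.v *)
From HB Require Import structures.
From mathcomp Require Import all_boot.
From mathcomp Require Import monoid.

Set Implicit Arguments.
Unset Strict Implicit.
Unset Printing Implicit Defensive.

Import Algebra.
Local Open Scope group_scope.

Definition is_identity (S : semigroupType) (e : S) : Prop :=
  forall x : S, e * x = x /\ x * e = x.

(* S^1 as a subset of [option S]: [None] is the adjoined identity, a member only when S has
   no identity of its own. *)
Definition inS1 (S : semigroupType) (u : option S) : Prop :=
  u = None -> ~ (exists e : S, is_identity e).

Definition mulS1r (S : semigroupType) (a : S) (u : option S) : S :=
  if u is Some x then a * x else a.

Definition mulS1l (S : semigroupType) (u : option S) (a : S) : S :=
  if u is Some x then x * a else a.

Definition Lstar (S : semigroupType) (a b : S) : Prop :=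
  forall x y : option S, inS1 x -> inS1 y ->
    (mulS1r a x = mulS1r a y <-> mulS1r b x = mulS1r b y).

Definition Rstar (S : semigroupType) (a b : S) : Prop :=
  forall x y : option S, inS1 x -> inS1 y ->
    (mulS1l x a = mulS1l y a <-> mulS1l x b = mulS1l y b).

Definition regular (S : semigroupType) : Prop :=
  forall x : S, exists y : S, x = x * y * x.

Definition idempotent_elt (S : semigroupType) (e : S) : Prop := e * e = e.

Definition abundant (S : semigroupType) : Prop :=
  [/\ ~ regular S,
      forall a : S, exists2 e : S, idempotent_elt e & Lstar a e
    & forall a : S, exists2 e : S, idempotent_elt e & Rstar a e].

(* The chain [n] = {1 < ... < n} is represented by 'I_n = {0 < ... < n-1};
   [r x = None] means that x is outside the domain of r. *)
Definition ptrans (n : nat) : Type := {ffun 'I_n -> option 'I_n}.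

HB.instance Definition _ n := Finite.on (ptrans n).

Section PartialTransformations.
Variable n : nat.
Implicit Types r s t : ptrans n.

(* Maps act on the right: x(rs) = (xr)s. *)
Definition pt_mul r s : ptrans n := [ffun x => obind s (r x)].

Definition pt_one : ptrans n := [ffun x => Some x].

Lemma pt_mulA : associative pt_mul.
Proof.
move=> r s t; apply/ffunP=> x; rewrite !ffunE.
by case: (r x) => //= y; rewrite ffunE.
Qed.

Lemma pt_mul1 : left_id pt_one pt_mul.
Proof. by move=> r; apply/ffunP=> x; rewrite !ffunE. Qed.

Lemma pt_mulr1 : right_id pt_one pt_mul.
Proof.
move=> r; apply/ffunP=> x; rewrite !ffunE.
by case: (r x) => //= y; rewrite ffunE.
Qed.

HB.instance Definition _ := isMonoid.Build (ptrans n) pt_mulA pt_mul1 pt_mulr1.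

Lemma pt_mulE r s x : (r * s) x = obind s (r x).
Proof. by rewrite ffunE. Qed.

Lemma pt_mulP r s x z :
  reflect (exists2 y, r x = Some y & s y = Some z) ((r * s) x == Some z).
Proof.
rewrite pt_mulE; apply: (iffP eqP); last by case=> y -> /=.
by case: (r x) => //= y; exists y.
Qed.

Definition Im r : {set 'I_n} := [set y | [exists x, r x == Some y]].

Definition height r : nat := #|Im r|.

Definition isotone r : bool :=
  [forall x : 'I_n, forall y : 'I_n, forall u : 'I_n, forall v : 'I_n,
     [&& x <= y, r x == Some u & r y == Some v] ==> (u <= v)].

Definition antitone r : bool :=
  [forall x : 'I_n, forall y : 'I_n, forall u : 'I_n, forall v : 'I_n,
     [&& x <= y, r x == Some u & r y == Some v] ==> (v <= u)].

Definition monotone r : bool := isotone r || antitone r.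

Definition decreasing r : bool :=
  [forall x : 'I_n, forall u : 'I_n, (r x == Some u) ==> (u <= x)].

Definition in_dorp r : bool := monotone r && decreasing r.

Lemma isotoneP r :
  reflect (forall x y u v : 'I_n, x <= y -> r x = Some u -> r y = Some v -> u <= v)
          (isotone r).
Proof.
apply: (iffP idP) => [ir x y u v xy rx ry | ir].
  by move/forallP: ir => /(_ x)/forallP/(_ y)/forallP/(_ u)/forallP/(_ v);
     rewrite xy rx ry !eqxx.
by do 4!apply/forallP=> ?; apply/implyP=> /and3P[xy /eqP rx /eqP ry]; apply: ir rx ry.
Qed.

Lemma antitoneP r :
  reflect (forall x y u v : 'I_n, x <= y -> r x = Some u -> r y = Some v -> v <= u)
          (antitone r).
Proof.
apply: (iffP idP) => [ir x y u v xy rx ry | ir].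
  by move/forallP: ir => /(_ x)/forallP/(_ y)/forallP/(_ u)/forallP/(_ v);
     rewrite xy rx ry !eqxx.
by do 4!apply/forallP=> ?; apply/implyP=> /and3P[xy /eqP rx /eqP ry]; apply: ir rx ry.
Qed.

Lemma decreasingP r :
  reflect (forall x u : 'I_n, r x = Some u -> u <= x) (decreasing r).
Proof.
apply: (iffP idP) => [dr x u rx | dr].
  by move/forallP: dr => /(_ x)/forallP/(_ u); rewrite rx eqxx.
by do 2!apply/forallP=> ?; apply/implyP=> /eqP; apply: dr.
Qed.

Lemma in_dorp_monoid_closed : monoid_closed in_dorp.
Proof.
split=> [|r s].
  rewrite unfold_in; apply/andP; split.
    by apply/orP; left; apply/isotoneP=> x y u v xy; rewrite !ffunE => -[<-] [<-].
  by apply/decreasingP=> x u; rewrite ffunE => -[<-].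
rewrite !unfold_in => /andP[mr /decreasingP dr] /andP[ms /decreasingP ds].
apply/andP; split; last first.
  apply/decreasingP=> x u /eqP/pt_mulP[y rx sy].
  exact: leq_trans (ds _ _ sy) (dr _ _ rx).
case/orP: mr => [/isotoneP | /antitoneP] mr; case/orP: ms => [/isotoneP | /antitoneP] ms;
  apply/orP; [left; apply/isotoneP | right; apply/antitoneP
             | right; apply/antitoneP | left; apply/isotoneP];
  move=> x y u v xy /eqP/pt_mulP[x' rx su] /eqP/pt_mulP[y' ry sv];
  have xy' := mr _ _ _ _ xy rx ry.
- exact: ms xy' su sv.
- exact: ms xy' su sv.
- exact: ms xy' sv su.
- exact: ms xy' sv su.
Qed.

Lemma height_mull r s : height (r * s) <= height r.
Proof.
pose f y := odflt y (s y).
apply: leq_trans (leq_imset_card f _); apply/subset_leq_card/subsetP=> z.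
rewrite inE => /existsP[x /pt_mulP[y rx sy]].
by apply/imsetP; exists y; rewrite ?inE /f ?sy //; apply/existsP; exists x; rewrite rx.
Qed.

Lemma height_mulr r s : height (r * s) <= height s.
Proof.
apply/subset_leq_card/subsetP=> z; rewrite !inE => /existsP[x /pt_mulP[y _ sy]].
by apply/existsP; exists y; rewrite sy.
Qed.

End PartialTransformations.

Record DORP (n : nat) := MkDORP { dorp_val :> ptrans n; _ : in_dorp dorp_val }.

HB.instance Definition _ n := [isSub for @dorp_val n].
HB.instance Definition _ n := [Finite of DORP n by <:].
HB.instance Definition _ n :=
  SubChoice_isSubMonoid.Build (ptrans n) (@in_dorp n) (DORP n) (@in_dorp_monoid_closed n).

Definition height_le (n p : nat) (r : DORP n) : bool := height r <= p.

Record Inp (n p : nat) := MkInp { inp_val :> DORP n; _ : height_le p inp_val }.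

Lemma height_le_mulg_closed n p : mulg_closed (@height_le n p).
Proof.
by move=> r s; rewrite !unfold_in => hr _; apply: leq_trans (height_mull _ _) hr.
Qed.

HB.instance Definition _ n p := [isSub for @inp_val n p].
HB.instance Definition _ n p := [Finite of Inp n p by <:].
HB.instance Definition _ n p :=
  SubChoice_isSubSemigroup.Build (DORP n) (@height_le n p) (Inp n p)
    (@height_le_mulg_closed n p).

Definition height_eq (n p : nat) (r : DORP n) : bool := height r == p.

Record layer (n p : nat) := MkLayer { layer_val :> DORP n; _ : height_eq p layer_val }.

HB.instance Definition _ n p := [isSub for @layer_val n p].
HB.instance Definition _ n p := [Finite of layer n p by <:].

(* [None] is the zero of the Rees quotient. *)
Definition RQ (p n : nat) : Type := option (layer n p).

HB.instance Definition _ p n := Finite.on (RQ p n).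

(* [insub] sends an element of height p to [Some] of it, all others to [None]. *)
Definition RQ_mul (p n : nat) (u v : RQ p n) : RQ p n :=
  match u, v with
  | Some r, Some s => insub ((r : DORP n) * (s : DORP n))
  | _, _ => None
  end.

Lemma RQ_mulA p n : associative (@RQ_mul p n).
Proof.
have hval (r : layer n p) : height (r : DORP n) = p by apply/eqP/(valP r).
case=> [r|//] [s|] [t|] //=; last by case: insubP.
rewrite /RQ_mul.
have [[hr hs] ht] := (hval r, hval s, hval t).
move: (layer_val r) (layer_val s) (layer_val t) hr hs ht => {}r {}s {}t hr hs ht.
case: (insubP (layer n p) (s * t)) => [st _ /= est | nst];
  case: (insubP (layer n p) (r * s)) => [rs _ /= ers | nrs] //.
- by rewrite est ers mulgA.
- rewrite est mulgA insubN //; apply: contra nrs; rewrite /height_eq => /eqP h.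
  rewrite eqn_leq -{2}h (height_mull (r * s : DORP n) t) andbT.
  by apply: leq_trans (height_mull r s) _; rewrite hr.
- rewrite ers -mulgA insubN //; apply: contra nst; rewrite /height_eq => /eqP h.
  rewrite eqn_leq -{2}h (height_mulr r (s * t : DORP n)) andbT.
  by apply: leq_trans (height_mull s t) _; rewrite hs.
Qed.

HB.instance Definition _ p n := isSemigroup.Build (RQ p n) (@RQ_mulA p n).

(* Main.v *)
(** For a monotone decreasing [a] let [g] send each [v] in [Im a] to the least point of its
    fibre.  Then [a g a = a] in the monoid of all partial transformations, and although [g] is
    not decreasing, the idempotents [g a] (the identity of [Im a]) and [a g] (each kernel class
    to its minimum) are isotone and decreasing.  They are Green [L]- and [R]-related to [a] among
    all partial transformations, so they have the height of [a] and are [L*]- and [R*]-related to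
    it in any subsemigroup.  The shift [i |-> i - 1] on [{2, ..., p + 1}] is not regular, because
    a decreasing [y] cannot send [1] into its domain. *)

Require Import Defs.
From mathcomp Require Import all_boot.
From Corelib Require Import Setoid.

Set Implicit Arguments.
Unset Strict Implicit.
Unset Printing Implicit Defensive.

(** * The fibre-minimum map and its two idempotent products *)

Section FibreMinimum.
Import Algebra.
Local Open Scope group_scope.
Variable n : nat.
Implicit Types a r s : ptrans n.

Definition fibre_min a : ptrans n :=
  [ffun v => [pick m | (a m == Some v) && [forall y, (a y == Some v) ==> (m <= y)]]].

Lemma fibre_minP a v m :
  fibre_min a v = Some m ->
  a m = Some v /\ forall y, a y = Some v -> m <= y.
Proof.
rewrite ffunE; case: pickP => // k /andP[/eqP ak /forallP mink] [<-]; split=> // y ay.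
by have := mink y; rewrite ay eqxx.
Qed.

Lemma fibre_min_def a (x v : 'I_n) :
  a x = Some v -> exists m, fibre_min a v = Some m.
Proof.
move=> ax; rewrite ffunE; case: pickP => [m _|none]; first by exists m.
have ax' : a x == Some v by apply/eqP.
(* Test the failed search at an actual least preimage of [v]. *)
have := none [arg min_(y < x | a y == Some v) (y : nat)].
case: arg_minnP => // m am minm; rewrite am /= => /negbT/forallPn[y].
by rewrite negb_imply => /andP[/minm ->].
Qed.

Lemma mul_fibre_minK a : a * fibre_min a * a = a.
Proof.
apply/ffunP=> x; rewrite !pt_mulE; case ax: (a x) => [v|] //=.
by have [m gv] := fibre_min_def ax; rewrite gv /=; case: (fibre_minP gv).
Qed.

Lemma fibre_min_mulE a v w : (fibre_min a * a) v = Some w -> w = v.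
Proof. by move=> /eqP/pt_mulP[m /fibre_minP[-> _]] []. Qed.

Lemma fibre_min_mul_idem a : idempotent_elt (fibre_min a * a).
Proof. by rewrite /idempotent_elt -mulgA [a * _]mulgA mul_fibre_minK. Qed.

Lemma mul_fibre_min_idem a : idempotent_elt (a * fibre_min a).
Proof. by rewrite /idempotent_elt mulgA mul_fibre_minK. Qed.

(** By [fibre_min_mulE] the product is a restriction of the identity map. *)
Lemma fibre_min_mul_dorp a : in_dorp (fibre_min a * a).
Proof.
apply/andP; split.
  by apply/orP; left; apply/isotoneP=> x y u v xy /fibre_min_mulE-> /fibre_min_mulE->.
by apply/decreasingP=> x u /fibre_min_mulE->.
Qed.

Lemma mul_fibre_min_dorp a : monotone a -> in_dorp (a * fibre_min a).
Proof.
move=> mono_a.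
have ltx x m : (a * fibre_min a) x = Some m -> m <= x.
  by move=> /eqP/pt_mulP[v ax /fibre_minP[_]]; apply.
apply/andP; split; last by apply/decreasingP.
apply/orP; left; apply/isotoneP=> x y m m' xy ex ey.
have mx := ltx _ _ ex.
move: ex ey => /eqP/pt_mulP[v ax gv] /eqP/pt_mulP[w ay gw].
have [am' _] := fibre_minP gw.
rewrite leqNgt; apply/negP=> m'm.
have m'x : m' <= x by apply: leq_trans mx; apply: ltnW.
(* Here [m' <= x <= y], and [a] takes the value [w] at both [m'] and [y], so monotonicity of either
   kind squeezes [v] to [w]; both minima then belong to one fibre. *)
have vw : v = w.
  apply/val_inj/eqP; rewrite eqn_leq.
  case/orP: mono_a => [/isotoneP|/antitoneP] mono_a.
    by rewrite (mono_a _ _ _ _ xy ax ay) (mono_a _ _ _ _ m'x am' ax).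
  by rewrite (mono_a _ _ _ _ xy ax ay) (mono_a _ _ _ _ m'x am' ax).
by move: gv m'm; rewrite vw gw => -[->]; rewrite ltnn.
Qed.

(** Since [a * fibre_min a * a = a], each of the two products is a left multiple of the other, and
    left multiplication never raises the height. *)
Lemma height_fibre_min_mull a r : height (fibre_min a * a * r) = height (a * r).
Proof.
apply/eqP; rewrite eqn_leq -mulgA height_mulr /=.
by rewrite -{1}(mul_fibre_minK a) -!mulgA height_mulr.
Qed.

Lemma height_mul_fibre_minr a r : height (r * (a * fibre_min a)) = height (r * a).
Proof.
apply/eqP; rewrite eqn_leq mulgA height_mull /=.
by rewrite -{1}(mul_fibre_minK a) !mulgA height_mull.
Qed.

(** Left multiplication by [fibre_min a] turns the first equation into the second; left
    multiplication by [a] turns it back. *)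
Lemma fibre_min_mul_inj a r s :
  a * r = a * s <-> fibre_min a * a * r = fibre_min a * a * s.
Proof.
split=> [eq_a|eq_e]; first by rewrite -!mulgA eq_a.
by have := congr1 (mul a) eq_e; rewrite !mulgA mul_fibre_minK.
Qed.

Lemma mul_fibre_min_inj a r s :
  r * a = s * a <-> r * (a * fibre_min a) = s * (a * fibre_min a).
Proof.
split=> [eq_a|eq_e]; first by rewrite !mulgA eq_a.
by have := congr1 (mul^~ a) eq_e; rewrite -!mulgA [a * _]mulgA mul_fibre_minK.
Qed.

End FibreMinimum.

(** * The two idempotents as elements of [DORP n] *)

Section Idempotents.
Import Algebra.
Local Open Scope group_scope.
Variable n : nat.
Implicit Types a x y : DORP n.

Lemma dorp_monotone a : monotone a.
Proof. by have /andP[] := valP a. Qed.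

Definition dorp_limg a : DORP n := MkDORP (fibre_min_mul_dorp a).
Definition dorp_rker a : DORP n := MkDORP (mul_fibre_min_dorp (dorp_monotone a)).

Lemma dorp_limg_idem a : idempotent_elt (dorp_limg a).
Proof. exact/val_inj/fibre_min_mul_idem. Qed.

Lemma dorp_rker_idem a : idempotent_elt (dorp_rker a).
Proof. exact/val_inj/mul_fibre_min_idem. Qed.

Lemma height_dorp_limg_mul a x : height (dorp_limg a * x : DORP n) = height (a * x : DORP n).
Proof. exact: height_fibre_min_mull. Qed.

Lemma height_mul_dorp_rker a x : height (x * dorp_rker a : DORP n) = height (x * a : DORP n).
Proof. exact: height_mul_fibre_minr. Qed.

Lemma height_dorp_limg a : height (dorp_limg a) = height a.
Proof. by have := height_dorp_limg_mul a 1; rewrite !mulg1. Qed.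

Lemma height_dorp_rker a : height (dorp_rker a) = height a.
Proof. by have := height_mul_dorp_rker a 1; rewrite !mul1g. Qed.

Lemma dorp_limg_mul_inj a x y : a * x = a * y <-> dorp_limg a * x = dorp_limg a * y.
Proof.
split=> /(congr1 (@dorp_val n)) eq_xy; apply: val_inj.
  exact: (fibre_min_mul_inj a x y).1 eq_xy.
exact: (fibre_min_mul_inj a x y).2 eq_xy.
Qed.

Lemma mul_dorp_rker_inj a x y : x * a = y * a <-> x * dorp_rker a = y * dorp_rker a.
Proof.
split=> /(congr1 (@dorp_val n)) eq_xy; apply: val_inj.
  exact: (mul_fibre_min_inj a x y).1 eq_xy.
exact: (mul_fibre_min_inj a x y).2 eq_xy.
Qed.

End Idempotents.

(** * A non-regular element of height exactly [p] *)

Section Shift.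
Import Algebra.
Variables (n p : nat).
Hypotheses (p_ge1 : 1 <= p) (p_le : p <= n - 1).

(** Points are counted from 0: the domain is [1..p], which fits because [p <= n - 1], and the image
    is [0..p-1]. *)
Definition shift_pt : ptrans n :=
  [ffun x : 'I_n => if 0 < x <= p then insub x.-1 else None].

Lemma shift_ptP (x u : 'I_n) : shift_pt x = Some u <-> x = u.+1 :> nat /\ u < p.
Proof.
rewrite ffunE; split.
  by case: ifP => // /andP[x0 xp]; case: insubP => // v _ vx [<-]; rewrite vx prednK.
case=> -> up /=; rewrite up; case: insubP => [v _ vu|/negP[]] //=.
by congr Some; apply: val_inj.
Qed.

Lemma shift_dorp : in_dorp shift_pt.
Proof.
apply/andP; split.
  apply/orP; left; apply/isotoneP=> x y u v xy /shift_ptP[xu _] /shift_ptP[yv _].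
  by rewrite -ltnS -xu -yv.
by apply/decreasingP=> x u /shift_ptP[-> _].
Qed.

Lemma height_shift : height shift_pt = p.
Proof.
have n_gt0 : 0 < n by move: (leq_trans p_ge1 p_le); rewrite subn_gt0; apply: leq_trans.
have pn : p < n by rewrite -(subnK n_gt0) addn1 ltnS.
rewrite /height -[RHS]card_ord.
(* The image is an initial segment, counted as an injective copy of ['I_p]. *)
have winj : injective (widen_ord (ltnW pn)).
  by move=> u v /(congr1 val) /= uv; apply: val_inj.
rewrite -(card_imset _ winj); apply: eq_card => v.
rewrite inE; apply/existsP/imsetP => [[x /eqP/shift_ptP[_ vp]]|[u _ ->]].
  by exists (Ordinal vp) => //; apply: val_inj.
by exists (Ordinal (leq_ltn_trans (ltn_ord u) pn)); apply/eqP/shift_ptP; split=> /=.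
Qed.

Definition shift : DORP n := MkDORP shift_dorp.

Lemma shift_not_regular (y : DORP n) : shift <> (shift * y * shift)%g.
Proof.
move=> /(congr1 (@dorp_val n)) eq_s.
have n_gt1 : 1 < n by move: (leq_trans p_ge1 p_le); rewrite subn_gt0.
(* At the point 1, [shift] gives 0, and [y] must send 0 to some [v] that [shift] maps to 0; so [v]
   is 1, against [v <= 0]. *)
have s1 : shift_pt (Ordinal n_gt1) = Some (Ordinal (ltnW n_gt1)) by apply/shift_ptP.
have : (shift_pt * (y : ptrans n) * shift_pt)%g (Ordinal n_gt1) = Some (Ordinal (ltnW n_gt1)).
  exact: etrans (esym (congr1 (fun r : ptrans n => r (Ordinal n_gt1)) eq_s)) s1.
move=> /eqP/pt_mulP[v /eqP/pt_mulP[u]]; rewrite s1 => -[<-] yv /shift_ptP[v1 _].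
have /andP[_ /decreasingP dec_y] := valP y.
by have := dec_y _ _ yv; rewrite v1.
Qed.

End Shift.

(** * Abundance of the ideal *)

Section Ideal.
Import Algebra.
Local Open Scope group_scope.
Variables (n p : nat).

(** Reading the adjoined identity as the identity map turns both sides of the starred relations into
    products in the monoid [DORP n]. *)
Definition Inp1_val (u : option (Inp n p)) : DORP n := if u is Some x then x : DORP n else 1.

Lemma val_mulS1r (a : Inp n p) u : mulS1r a u = (a : DORP n) * Inp1_val u :> DORP n.
Proof. by case: u => [x|] //=; rewrite mulg1. Qed.

Lemma val_mulS1l (a : Inp n p) u : mulS1l u a = Inp1_val u * (a : DORP n) :> DORP n.
Proof. by case: u => [x|] //=; rewrite mul1g. Qed.

Lemma Inp_eq (a b : Inp n p) : a = b <-> a = b :> DORP n.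
Proof. by split=> [->|/val_inj]. Qed.

Lemma Inp_abundant (p_ge1 : (1 <= p)%N) (p_le : (p <= n - 1)%N) : abundant (Inp n p).
Proof.
split.
- have le_s : height_le p (shift n p) by rewrite /height_le height_shift.
  by move=> /(_ (MkInp le_s))[y] /(congr1 (@inp_val n p)); apply: shift_not_regular.
- move=> a; have le_e : height_le p (dorp_limg a).
    by rewrite /height_le height_dorp_limg; apply: (valP a).
  exists (MkInp le_e); first exact/val_inj/dorp_limg_idem.
  by move=> x y _ _; rewrite !Inp_eq !val_mulS1r; apply: dorp_limg_mul_inj.
- move=> a; have le_e : height_le p (dorp_rker a).
    by rewrite /height_le height_dorp_rker; apply: (valP a).
  exists (MkInp le_e); first exact/val_inj/dorp_rker_idem.
  by move=> x y _ _; rewrite !Inp_eq !val_mulS1l; apply: mul_dorp_rker_inj.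
Qed.

End Ideal.

(** * Abundance of the Rees quotient *)

Section ReesQuotient.
Import Algebra.
Local Open Scope group_scope.
Variables (n p : nat).
Hypothesis p_ge1 : (1 <= p)%N.

Definition empty_pt : ptrans n := [ffun=> None].

Lemma empty_dorp : in_dorp empty_pt.
Proof.
apply/andP; split; last by apply/decreasingP=> x u; rewrite ffunE.
by apply/orP; left; apply/isotoneP=> x y u v _; rewrite ffunE.
Qed.

Lemma height_empty : height empty_pt = 0%N.
Proof.
by apply: eq_card0 => v; rewrite inE; apply/existsP=> -[x]; rewrite ffunE.
Qed.

(* The empty map has height [0 < p], so it can stand for the zero of the Rees quotient. *)
Definition RQ1_val (u : option (RQ p n)) : DORP n :=
  match u with
  | None => 1
  | Some None => MkDORP empty_dorp
  | Some (Some r) => r : DORP n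
  end.

Lemma insub_height_lt (r : DORP n) : height r < p -> insub r = None :> RQ p n.
Proof. by move=> hr; rewrite insubN // /height_eq neq_ltn hr. Qed.

Lemma RQ_mulS1r (a : layer n p) u :
  mulS1r (Some a : RQ p n) u = insub ((a : DORP n) * RQ1_val u).
Proof.
case: u => [[r|]|] //=; last by rewrite mulg1 valK.
(* A product with the empty map has height 0, below [p], so [insub] returns the zero. *)
by rewrite insub_height_lt // (leq_ltn_trans (height_mulr _ _)) //= height_empty.
Qed.

Lemma RQ_mulS1l (a : layer n p) u :
  mulS1l u (Some a : RQ p n) = insub (RQ1_val u * (a : DORP n)).
Proof.
case: u => [[r|]|] //=; last by rewrite mul1g valK.
by rewrite insub_height_lt // (leq_ltn_trans (height_mull _ _)) //= height_empty.
Qed.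

(** [insub] is injective on height [p] and collapses every other height to the zero. *)
Lemma insub_layer_eq (r s : DORP n) :
  insub r = insub s :> RQ p n <->
  if height r == p then r = s else height s != p.
Proof.
rewrite -[height r == p]/(height_eq p r) -[height s == p]/(height_eq p s).
case: (insubP (layer n p) r) => [u hr <-|/negPf hr]; rewrite ?(valP u) ?hr.
  split=> [|<-]; last by rewrite valK.
  by case: insubP => // v _ <- [->].
by case: insubP => [v ->|->].
Qed.

(** Equal heights make the same products vanish, so an equivalence of equations in [DORP n] passes
    to the quotient. *)
Lemma insub_layer_transfer (r s r' s' : DORP n) :
  height r' = height r -> height s' = height s -> (r = s <-> r' = s') ->
  insub r = insub s :> RQ p n <-> insub r' = insub s' :> RQ p n.
Proof.
by move=> hr hs eq_rs; rewrite !insub_layer_eq hr hs; case: ifP.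
Qed.

Lemma RQ_abundant (p_le : (p <= n - 1)%N) : abundant (RQ p n).
Proof.
split.
- have eq_s : height_eq p (shift n p) by rewrite /height_eq height_shift.
  move=> /(_ (Some (MkLayer eq_s)))[[y|] //=].
  (* The left side is nonzero, so both [insub]s succeed and the equation holds in [DORP n]. *)
  rewrite /mul /= /RQ_mul; case: insubP => // t _ /= def_t; case: insubP => // u _ /= def_u [].
  by move=> eq_u; apply: (shift_not_regular p_ge1 p_le (y := y)); rewrite -def_t -def_u -eq_u.
(* The zero is idempotent and serves as its own partner. *)
- case=> [a|]; last by exists None.
  have eq_e : height_eq p (dorp_limg a).
    by rewrite /height_eq height_dorp_limg; apply: (valP a).
  exists (Some (MkLayer eq_e)).
    rewrite /idempotent_elt -[LHS]/(insub _) /= dorp_limg_idem.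
    exact: (valK (MkLayer eq_e)).
  move=> x y _ _; rewrite !RQ_mulS1r; apply: insub_layer_transfer.
  + exact: height_dorp_limg_mul.
  + exact: height_dorp_limg_mul.
  + exact: dorp_limg_mul_inj.
- case=> [a|]; last by exists None.
  have eq_e : height_eq p (dorp_rker a).
    by rewrite /height_eq height_dorp_rker; apply: (valP a).
  exists (Some (MkLayer eq_e)).
    rewrite /idempotent_elt -[LHS]/(insub _) /= dorp_rker_idem.
    exact: (valK (MkLayer eq_e)).
  move=> x y _ _; rewrite !RQ_mulS1l; apply: insub_layer_transfer.
  + exact: height_mul_dorp_rker.
  + exact: height_mul_dorp_rker.
  + exact: mul_dorp_rker_inj.
Qed.

End ReesQuotient.

Theorem lemma2p20 (n p : nat) (p_ge1 : 1 <= p) (p_le : p <= n - 1) :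
  abundant (RQ p n) /\ abundant (Inp n p).
Proof. by split; [apply: RQ_abundant | apply: Inp_abundant]. Qed.
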